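(* Let $q\ge 8$ be a prime power. Then there exist asymmetric quantum convolutional codes with the following parameters, each for some memory $\mu^*$: (a) $[(q-1,\ i-t-1,\ \mu^*;\ 3,\ (d_z)_f/(d_x)_f)]_q$, where $(d_z)_f\ge q-i-1$ and $(d_x)_f\ge t+2$, for all integers $i,t$ with $1\le t\le i-2$ and $3\le i\le q-3$; (b) $[(q-1,\ i-t,\ \mu^*;\ 2,\ (d_z)_f/(d_x)_f)]_q$, where $(d_z)_f\ge q-i-1$ and $(d_x)_f\ge t+2$, for all integers $i,t$ with $1\le t\le i-1$ and $2\le i\le q-3$. (In both items the two lower bounds are interchanged if $t+2>q-i-1$.)
   Context: Convolutional notions. A matrix over $\mathbb F_q[D]$ is basic if it has a polynomial right inverse. The weight of $\mathbf v(D)\in\mathbb F_q[D]^n$ is the total number of nonzero coefficients of its $n$ components. The Euclidean dual of a submodule $V\subseteq\mathbb F_q[D]^n$ is $V^\perp=\{\mathbf u(D)\in\mathbb F_q[D]^n:\ \mathbf u(D)\mathbf v(1/D)^t=0\ \text{for all }\mathbf v(D)\in V\}$ (the superscript $t$ on vectors and matrices denotes transpose). Asymmetric quantum convolutional code (AQCC), CSS type. It is specified by a basic (hence full-rank) stabilizer matrix $$S(D)=\begin{pmatrix}A(D)&|&0\\0&|&B(D)\end{pmatrix},\quad A\in\mathbb F_q[D]^{r\times n},\ B\in\mathbb F_q[D]^{s\times n},\quad A(D)B(1/D)^t=0$$ (symplectic orthogonality). Let $\mathcal A,\mathcal B\subseteq\mathbb F_q[D]^n$ be the row modules of $A$ and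 $B$; then $\mathcal A\subseteq\mathcal B^\perp$ and $\mathcal B\subseteq\mathcal A^\perp$. The code has parameters $[(n,K,\mu^*;\gamma,(d_z)_f/(d_x)_f)]_q$, where: $n$ is the frame size; $K=n-r-s$ is the number of logical qudits per frame; $\mu^*$ is the memory, i.e. the maximal degree of an entry of $S(D)$; $\gamma$ is the degree, i.e. the overall constraint length (sum over the rows of $S(D)$ of the maximal degree in the row), required to be minimal among all basic matrices with the same row module; and, with $\operatorname{wt}(T)$ denoting the minimum weight of an element of $T$, $(d_z)_f$ and $(d_x)_f$ are respectively the maximum and the minimum of the two numbers $\operatorname{wt}(\mathcal B^\perp\setminus\mathcal A)$ and $\operatorname{wt}(\mathcal A^\perp\setminus\mathcal B)$. Convention: whenever the value (bound) given for $(d_x)_f$ is larger than the one given for $(d_z)_f$, the two are interchanged. Writing $\mu^*$ means that no claim is made about the value of the memory. *)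

(* Defs.v *)
From HB Require Import structures.
From mathcomp Require Import all_boot all_order all_algebra.

Set Implicit Arguments.
Unset Strict Implicit.
Unset Printing Implicit Defensive.

Import GRing.Theory.
Local Open Scope ring_scope.

Section Convolutional.
Variable F : fieldType.

(* p(1/D), computed in the field F(D) of rational functions, where D = 'X. *)
Definition eval_inv (p : {poly F}) : {fraction {poly F}} :=
  (map_poly (fun c : F => tofrac c%:P) p).[(tofrac 'X)^-1].

(* U(D) V(1/D)^t, with entries in F(D). *)
Definition pairing m1 m2 n (U : 'M[{poly F}]_(m1, n)) (V : 'M[{poly F}]_(m2, n)) :
    'M[{fraction {poly F}}]_(m1, m2) :=
  map_mx (@tofrac {poly F}) U *m (map_mx eval_inv V)^T.

Definition basic m n (M : 'M[{poly F}]_(m, n)) : Prop :=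
  exists N : 'M[{poly F}]_(n, m), M *m N = 1%:M.

Definition row_module m n (M : 'M[{poly F}]_(m, n)) (v : 'rV[{poly F}]_n) : Prop :=
  exists w : 'rV[{poly F}]_m, v = w *m M.

Definition edual n (V : 'rV[{poly F}]_n -> Prop) (u : 'rV[{poly F}]_n) : Prop :=
  forall v, V v -> pairing u v = 0.

Definition weight n (v : 'rV[{poly F}]_n) : nat :=
  (\sum_(j < n) count (fun c : F => c != 0%R) (v 0%R j))%N.

(* wt(T) = d; this entails that T is nonempty. *)
Definition is_min_weight n (T : 'rV[{poly F}]_n -> Prop) (d : nat) : Prop :=
  (exists2 v, T v & weight v = d) /\ (forall v, T v -> (d <= weight v)%N).

(* The degree of a nonzero polynomial p is (size p).-1; zero entries count as
   degree 0. *)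
Definition row_degree m n (M : 'M[{poly F}]_(m, n)) (i : 'I_m) : nat :=
  (\max_(j < n) (size (M i j)).-1)%N.

Definition memory m n (M : 'M[{poly F}]_(m, n)) : nat :=
  (\max_(i < m) row_degree M i)%N.

Definition constraint_length m n (M : 'M[{poly F}]_(m, n)) : nat :=
  (\sum_(i < m) row_degree M i)%N.

Definition stabilizer r s n (A : 'M[{poly F}]_(r, n)) (B : 'M[{poly F}]_(s, n)) :
    'M[{poly F}]_(r + s, n + n) :=
  block_mx A 0 0 B.

(* The CSS code with stabilizer matrix S(D) = diag(A(D), B(D)) has parameters
   [(n, K, mu; gamma, dz/dx)]_q, where q = #|F|. *)
Record aqcc_params r s n (A : 'M[{poly F}]_(r, n)) (B : 'M[{poly F}]_(s, n))
    (K mu gamma dz dx : nat) : Prop := AqccParams {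
  aqcc_basic : basic (stabilizer A B);
  aqcc_orthogonal : pairing A B = 0;
  aqcc_logical : (K + r + s)%N = n;
  aqcc_memory : mu = memory (stabilizer A B);
  aqcc_degree : gamma = constraint_length (stabilizer A B);
  aqcc_degree_min : forall m (M : 'M[{poly F}]_(m, n + n)),
    basic M ->
    (forall v, row_module M v <-> row_module (stabilizer A B) v) ->
    (gamma <= constraint_length M)%N;
  aqcc_distances : exists d1 d2 : nat,
    [/\ is_min_weight (fun v => edual (row_module B) v /\ ~ row_module A v) d1,
        is_min_weight (fun v => edual (row_module A) v /\ ~ row_module B v) d2,
        dz = maxn d1 d2 & dx = minn d1 d2]
}.

Definition aqcc (n K mu gamma dz dx : nat) : Prop :=
  exists (r s : nat) (A : 'M[{poly F}]_(r, n)) (B : 'M[{poly F}]_(s, n)),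
    aqcc_params A B K mu gamma dz dx.

End Convolutional.

(* Main.v *)
Require Import Defs.
From HB Require Import structures.
From mathcomp Require Import all_boot all_order all_algebra.
From mathcomp Require Import cyclic finfield zify ring.
From Stdlib Require Import Classical.

(* Let z be a primitive root of unity of order n = q - 1 and v_k = (z^(jk))_j.
   Since <v_a, v_b> = 0 unless n divides a + b, the block code A spanned by
   v_1, ..., v_r is orthogonal to the code B generated by v_1, ..., v_s and
   v_(s+1) + D^g v_0 whenever r + s + 1 < n. The lowest coefficient of a nonzero
   u in the dual of B is orthogonal to the s + 1 consecutive vectors
   v_0, ..., v_s, so the BCH bound gives weight at least s + 2; in the dual of A
   it gives r + 1. The degree g is minimal because some constant combination of
   the maximal minors of the stabilizer matrix equals D^g. The theorem is the
   case r = q - i - 2, with s = t + 1, g = 3 in (a) and s = t, g = 2 in (b). *)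

Section AsymmetricConvolutional.
Set Implicit Arguments.
Unset Strict Implicit.
Import GRing.Theory.
Local Open Scope ring_scope.
Variable F : fieldType.
Local Notation polyF := {poly F}.

(** * Substitution of 1/D and Euclidean duality *)

(** Up to conversion [eval_inv] embeds the coefficients and then evaluates, so it inherits the ring
    morphism structure that the matrix lemmas require. *)
HB.instance Definition _ := GRing.RMorphism.copy (@eval_inv F)
  (horner_eval (tofrac 'X)^-1 \o map_poly (@tofrac polyF \o polyC)).

Lemma eval_invE (p : polyF) :
  eval_inv p = (map_poly (@tofrac polyF \o polyC) p).[(tofrac 'X)^-1].
Proof. by []. Qed.

Lemma eval_invC (c : F) : eval_inv c%:P = tofrac c%:P.
Proof. by rewrite eval_invE map_polyC hornerC. Qed.

Lemma eval_invX : eval_inv ('X : polyF) = (tofrac 'X)^-1.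
Proof. by rewrite eval_invE map_polyX hornerX. Qed.

Lemma pairing_mulr m1 m2 m3 n (U : 'M[polyF]_(m1, n)) (W : 'M_(m2, m3))
    (V : 'M_(m3, n)) :
  pairing U (W *m V) = pairing U V *m (map_mx (@eval_inv F) W)^T.
Proof. by rewrite /pairing map_mxM trmx_mul mulmxA. Qed.

(** Conjugate linearity in the second argument ([pairing_mulr]) reduces duality to the generating
    rows. *)
Lemma edual_row_moduleP m n (V : 'M[polyF]_(m, n)) (u : 'rV_n) :
  edual (row_module V) u <-> pairing u V = 0.
Proof.
split=> [uV | uV0 _ [w ->]]; last by rewrite pairing_mulr uV0 mul0mx.
apply/matrixP=> i j; rewrite ord1 [RHS]mxE.
have /matrixP/(_ 0 0) : pairing u (delta_mx (0 : 'I_1) j *m V) = 0.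
  by apply: uV; exists (delta_mx 0 j).
by rewrite pairing_mulr map_delta_mx trmx_delta -colE !mxE.
Qed.

Lemma pairing_const m1 m2 n (U : 'M[polyF]_(m1, n)) (V : 'M[F]_(m2, n)) :
  pairing U (map_mx polyC V) = map_mx (@tofrac polyF) (U *m (map_mx polyC V)^T).
Proof.
rewrite /pairing map_mxM; congr (_ *m _).
by apply/matrixP=> i j; rewrite !mxE eval_invC.
Qed.

Lemma map_tofrac_eq0 m n (M : 'M[polyF]_(m, n)) :
  map_mx (@tofrac polyF) M = 0 <-> M = 0.
Proof.
split=> [/matrixP M0 | ->]; last by rewrite map_mx0.
by apply/matrixP=> i j; have /eqP := M0 i j; rewrite !mxE tofrac_eq0 => /eqP.
Qed.

Lemma pairing_const_eq0 m1 m2 n (U : 'M[polyF]_(m1, n)) (V : 'M[F]_(m2, n)) :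
  pairing U (map_mx polyC V) = 0 <-> U *m (map_mx polyC V)^T = 0.
Proof. by rewrite pairing_const map_tofrac_eq0. Qed.

(** At 1/D the pencil becomes V0 + D^(-g) V1; multiplying by D^g clears the denominator. *)
Lemma pairing_pencil_eq0 g m1 m2 n (U : 'M[polyF]_(m1, n)) (V0 V1 : 'M[F]_(m2, n)) :
  pairing U (map_mx polyC V0 + 'X^g *: map_mx polyC V1) = 0 <->
  'X^g *: (U *m (map_mx polyC V0)^T) + U *m (map_mx polyC V1)^T = 0.
Proof.
have Xg0 : tofrac ('X^g : polyF) != 0.
  by rewrite tofrac_eq0 -size_poly_eq0 size_polyXn.
have -> : pairing U (map_mx polyC V0 + 'X^g *: map_mx polyC V1)
  = (tofrac 'X^g)^-1 *: map_mx (@tofrac polyF)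
      ('X^g *: (U *m (map_mx polyC V0)^T) + U *m (map_mx polyC V1)^T).
  rewrite map_mxD map_mxZ -!pairing_const scalerDr scalerA mulVf // scale1r.
  rewrite /pairing map_mxD map_mxZ linearD linearZ /= mulmxDr -scalemxAr.
  by rewrite rmorphXn /= eval_invX rmorphXn /= exprVn.
split=> [/eqP|->]; last by rewrite map_mx0 scaler0.
by rewrite scaler_eq0 invr_eq0 (negPf Xg0) /= => /eqP /map_tofrac_eq0.
Qed.

(** * Weights of polynomial vectors *)

Lemma weight_coef n (v : 'rV[polyF]_n) a :
  (#|[set j | ((v 0 j)`_a != 0)%R]| <= weight v)%N.
Proof.
rewrite -sum1dep_card big_mkcond /weight; apply: leq_sum => j _.
case: ifP => // nz; rewrite -has_count; apply/hasP; exists (v 0 j)`_a => //.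
by apply: mem_nth; rewrite ltnNge; apply: contra nz => le; rewrite nth_default.
Qed.

(** [T] need not be decidable, hence the classical argument: without a minimum, induction makes
    every number a lower bound. *)
Lemma min_weight_exists n (T : 'rV[polyF]_n -> Prop) v :
  T v -> exists d, is_min_weight T d.
Proof.
move=> Tv; apply: NNPP => no_min.
have ge m : forall u, T u -> (m <= weight u)%N.
  elim: m => // m IH u Tu; rewrite ltn_neqAle IH // andbT.
  by apply/eqP=> eq_m; apply: no_min; exists m; split=> //; exists u.
by have := ge (weight v).+1 v Tv; rewrite ltnn.
Qed.

(** * Determinants, row degrees and minimal constraint length *)

(** Each term of the Leibniz expansion takes one entry from each row. *)
Lemma size_det_leq m (Q : 'M[polyF]_m) (d : 'I_m -> nat) :
  (forall i j, (size (Q i j) <= (d i).+1)%N) ->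
  ((size (\det Q)).-1 <= \sum_i d i)%N.
Proof.
move=> leQ; rewrite -subn1 leq_subLR add1n.
apply: leq_trans (size_sum _ _ _) _; apply/bigmax_leqP => s _.
rewrite size_Msign; apply: leq_trans (size_poly_prod_leq _ _) _.
rewrite leq_subLR -sum1_card addnS ltnS -big_split /=.
by apply: leq_sum => i _; rewrite add1n.
Qed.

Lemma size_mulmx_const m n k (M : 'M[polyF]_(m, n)) (P : 'M[F]_(n, k)) i j :
  (size ((M *m map_mx polyC P) i j) <= (row_degree M i).+1)%N.
Proof.
rewrite mxE; apply: leq_trans (size_sum _ _ _) _; apply/bigmax_leqP => l _.
rewrite mxE mulrC mul_polyC; apply: leq_trans (size_scale_leq _ _) _.
by apply: leq_trans (leqSpred _) _; rewrite ltnS /row_degree (bigD1 l) //= leq_maxl.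
Qed.

Lemma row_submoduleP m1 m2 n (M : 'M[polyF]_(m1, n)) (N : 'M_(m2, n)) :
  (forall v, row_module M v -> row_module N v) -> exists U, M = U *m N.
Proof.
move=> sub; have /fin_all_exists[w wE] (i : 'I_m1) : exists w, row i M = w *m N.
  by apply: sub; exists (delta_mx 0 i); rewrite rowE.
by exists (\matrix_i w i); apply/row_matrixP=> i; rewrite row_mul rowK wE.
Qed.

(* A maximal minor of a basic matrix depends only on the row module, up to a
   unit of F[D]; multiplying by a constant P extracts combinations of minors. *)
Lemma constraint_length_ge m1 m2 n (S : 'M[polyF]_(m1, n)) (M : 'M_(m2, n))
    (P : 'M[F]_(n, m1)) :
  basic S -> basic M -> (forall v, row_module M v <-> row_module S v) ->
  ((size (\det (S *m map_mx polyC P))).-1 <= constraint_length M)%N.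
Proof.
move=> [S' SS'] [M' MM'] eqMS.
have [U MU] : exists U, M = U *m S by apply: row_submoduleP => v /eqMS.
have [V SV] : exists V, S = V *m M by apply: row_submoduleP => v /eqMS.
(* V U S = S, and the right inverse of [S] cancels [S]; likewise for [M]. So [U] and [V] are
   mutually inverse, which forces equal numbers of rows. *)
have VU : V *m U = 1%:M.
  by rewrite -SS' -[V *m U]mulmx1 -{1}SS' !mulmxA -(mulmxA V) -MU -SV.
have UV : U *m V = 1%:M.
  by rewrite -MM' -[U *m V]mulmx1 -{1}MM' !mulmxA -(mulmxA U) -SV -MU.
have eq_m : m1 = m2 by apply/eqP; rewrite eqn_leq (mulmx1_min VU) (mulmx1_min UV).
case: _ / eq_m in M M' MM' eqMS U V MU SV VU UV *.
have detV : \det V \is a GRing.unit.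
  by apply/unitrPr; exists (\det U); rewrite -det_mulmx VU det1.
move: detV; rewrite SV -mulmxA det_mulmx poly_unitE => /andP[/size_poly1P[c c0 ->] _].
rewrite mul_polyC size_scale //; apply: size_det_leq => i j.
exact: size_mulmx_const.
Qed.

(** * Distance from consecutive parity checks *)

(* The BCH bound: the vanishing polynomial of all but one point of the support
   would otherwise be a combination of the m parity checks. *)
Lemma bch_bound n (x : 'I_n -> F) (c : 'rV[F]_n) a m :
  injective x -> (forall j, x j != 0) -> c != 0 ->
  (forall k, (k < m)%N -> \sum_j c 0 j * x j ^+ (a + k) = 0) ->
  (m < #|[set j | (c 0 j != 0)%R]|)%N.
Proof.
move=> x_inj x_neq0 /rV0Pn[j0 cj0] check; rewrite ltnNge; apply/negP => le_m.
set A := [set j | _] in le_m; pose f := \prod_(j in A :\ j0) ('X - (x j)%:P).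
have szf : (size f <= m)%N.
  rewrite /f -big_enum size_prod_XsubC -cardE (leq_trans _ le_m) //.
  by rewrite (cardsD1 j0 A) inE cj0.
have sum0 : \sum_j c 0 j * x j ^+ a * f.[x j] = 0.
  under eq_bigr => j _ do rewrite (horner_coef_wide _ szf) mulr_sumr.
  rewrite exchange_big big1 // => k _.
  transitivity (f`_k * \sum_j c 0 j * x j ^+ (a + k)).
    by rewrite mulr_sumr; apply: eq_bigr => j _; rewrite exprD mulrCA !mulrA.
  by rewrite check ?mulr0.
have : c 0 j0 * x j0 ^+ a * f.[x j0] != 0.
  rewrite !mulf_neq0 ?expf_neq0 // horner_prod.
  apply/prodf_neq0 => j; rewrite !inE => /andP[jj0 _].
  by rewrite hornerXsubC subr_eq0 (inj_eq x_inj) eq_sym.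
move: sum0; rewrite (bigD1 j0) //= big1 ?addr0 => [-> | j jj0]; first by rewrite eqxx.
have [-> | cj] := eqVneq (c 0 j) 0; first by rewrite !mul0r.
by rewrite horner_prod (bigD1 j) ?inE ?jj0 //= hornerXsubC subrr mul0r mulr0.
Qed.

(** * Power vectors of a primitive root of unity *)

Section PrimitiveRoot.
Variables (n : nat) (z : F).
Hypothesis z_prim : n.-primitive_root z.

Definition power_mx m (e : 'I_m -> nat) : 'M[F]_(m, n) :=
  \matrix_(i, j) z ^+ (j * e i).

Local Notation powC e := (map_mx polyC (power_mx e)).

(** A geometric sum: if z^a is not 1, factoring (z^a)^n - 1 = 0 makes it vanish. *)
Lemma sum_prim_root_expr a :
  \sum_(j < n) z ^+ (j * a) = n%:R * (n %| a)%:R.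
Proof.
under eq_bigr => j _ do rewrite mulnC exprM.
rewrite (prim_order_dvd z_prim); have [-> | za1] := eqVneq (z ^+ a) 1.
  under eq_bigr => j _ do rewrite expr1n.
  by rewrite sumr_const card_ord mulr1.
have /eqP := subrX1 (z ^+ a) n; rewrite exprAC (prim_expr_order z_prim) expr1n subrr.
by rewrite eq_sym mulf_eq0 subr_eq0 (negPf za1) mulr0 => /eqP.
Qed.

Lemma power_mxM m l (a : 'I_m -> nat) (b : 'I_l -> nat) :
  power_mx a *m (power_mx b)^T = \matrix_(i, k) (n%:R * (n %| a i + b k)%:R).
Proof.
apply/matrixP=> i k; rewrite !mxE -sum_prim_root_expr.
by apply: eq_bigr => j _; rewrite !mxE -exprD -mulnDr.
Qed.

Lemma power_mx_bch (c : 'rV[F]_n) a m :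
  c != 0 -> (forall k, (k < m)%N -> \sum_j c 0 j * z ^+ (j * (a + k)) = 0) ->
  (m < #|[set j | (c 0 j != 0)%R]|)%N.
Proof.
move=> c0 check; apply: (bch_bound (x := fun j : 'I_n => z ^+ j) (a := a)) => //.
- move=> j k /eqP; rewrite (eq_prim_root_expr z_prim) !modn_small // => /eqP.
  exact: val_inj.
- move=> j; rewrite expf_neq0 //.
  by rewrite (prim_root_eq0 z_prim) -lt0n (prim_order_gt0 z_prim).
- by move=> k /check E; rewrite -[RHS]E; apply: eq_bigr => j _; rewrite exprM.
Qed.

(** * The two stabilizer blocks and their constant dual matrices *)

Variables (r s g : nat).
Hypotheses (lt_rs : (r + s.+1 < n)%N) (g_gt0 : (0 < g)%N).

Definition const_block : 'M[polyF]_(r, n) := powC (fun i : 'I_r => i.+1).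

Definition pencil_coef : 'M[F]_(s.+1, n) := \matrix_(k, j) (k == ord_max)%:R.

(* The rows v_1, ..., v_s, v_(s+1) + D^g v_0, where v_k = (z^(jk))_j; both the
   rows of the D^0 coefficients and the leading coefficients are indexed by s+1
   consecutive integers. *)
Definition pencil_block : 'M[polyF]_(s.+1, n) :=
  powC (fun i : 'I_s.+1 => i.+1) + 'X^g *: map_mx polyC pencil_coef.

Lemma pencil_coefM l (e : 'I_l -> nat) :
  pencil_coef *m (power_mx e)^T =
  \matrix_(i, k) ((i == ord_max)%:R * (n%:R * (n %| e k)%:R)).
Proof.
apply/matrixP=> i k; rewrite !mxE -sum_prim_root_expr mulr_sumr.
by apply: eq_bigr => j _; rewrite !mxE.
Qed.

Lemma pencil_blockM l (e : 'I_l -> nat) :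
  pencil_block *m (powC e)^T = \matrix_(i, k)
    ((n%:R * (n %| i.+1 + e k)%:R)%:P
     + 'X^g * ((i == ord_max)%:R * (n%:R * (n %| e k)%:R))%:P).
Proof.
rewrite mulmxDl -scalemxAl !map_trmx -!map_mxM power_mxM pencil_coefM.
by apply/matrixP=> i k; rewrite !mxE.
Qed.

Let n_neq0 : n%:R != 0 :> F := prim_root_natf_neq0 z_prim.

Let dvdF a : (0 < a < n)%N -> (n %| a)%N = false.
Proof.
by case/andP=> a0 an; apply: contraTF an => /dvdn_leq; rewrite -leqNgt; apply.
Qed.

Let dvd_compl a b : (a < n)%N -> (0 < b < n)%N -> (n %| a + (n - b))%N = (a == b).
Proof.
move=> an bn; have [-> | ab] := eqVneq a b; first by rewrite subnKC ?dvdnn //; lia.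
apply/negP=> /dvdnP[[|[|k]]]; lia.
Qed.

Let lt_rn : (r < n)%N. Proof. lia. Qed.
Let lt_sn : (s.+1 < n)%N. Proof. lia. Qed.

(** Inverse Fourier transform: n^(-1) v_(n-k) is dual to v_k, so the transpose is a right inverse of
    either block. *)
Definition dual_mx m : 'M[F]_(m, n) :=
  n%:R^-1 *: power_mx (fun i : 'I_m => n - i.+1)%N.

(** The last dual vector becomes n^(-1) v_0, which annihilates v_(s+1) and reads off the coefficient
    D^g of v_0. *)
Definition lead_dual_mx : 'M[F]_(s.+1, n) :=
  n%:R^-1 *: power_mx (fun i : 'I_s.+1 => if i == ord_max then 0 else n - i.+1)%N.

Lemma const_blockM l (e : 'I_l -> nat) :
  const_block *m (powC e)^T = \matrix_(i, k) (n%:R * (n %| i.+1 + e k)%:R)%:P.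
Proof. by rewrite map_trmx -map_mxM power_mxM; apply/matrixP=> i k; rewrite !mxE. Qed.

Lemma const_block_dual : const_block *m map_mx polyC (dual_mx r)^T = 1%:M.
Proof.
rewrite -map_trmx map_mxZ linearZ -scalemxAr const_blockM; apply/matrixP=> i k.
rewrite !mxE -polyCM mulKf // dvd_compl ?eqSS; first by rewrite polyC_natr.
  by have := ltn_ord i; lia.
by have := ltn_ord k; lia.
Qed.

(** For 0 < k < n, v_(n-k) is orthogonal to v_0, so the D^g term contributes nothing. *)
Lemma pencil_block_dual : pencil_block *m map_mx polyC (dual_mx s.+1)^T = 1%:M.
Proof.
rewrite -map_trmx map_mxZ linearZ -scalemxAr pencil_blockM; apply/matrixP=> i k.
have := ltn_ord k; have := ltn_ord i => lt_i lt_k.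
rewrite !mxE (dvdF (a := n - k.+1)) ?mulr0 ?addr0; last by lia.
rewrite -polyCM mulKf // dvd_compl ?eqSS; first by rewrite polyC_natr.
  by lia.
by lia.
Qed.

Lemma pencil_block_lead_dual :
  pencil_block *m map_mx polyC lead_dual_mx^T =
  diag_mx (\row_i if i == ord_max then 'X^g else 1).
Proof.
rewrite -map_trmx map_mxZ linearZ -scalemxAr pencil_blockM; apply/matrixP=> i k.
have := ltn_ord k; have := ltn_ord i => lt_i lt_k.
rewrite !mxE; case: (k =P ord_max) => [-> | k_max].
  rewrite addn0 dvdF ?dvdn0 ?mulr0 ?add0r ?mulr1; last by lia.
  case: (i == ord_max); last by rewrite mul0r !mulr0.
  by rewrite mul1r mulrCA -polyCM mulVf // mulr1.
rewrite (dvdF (a := n - k.+1)) ?mulr0 ?addr0; last by lia.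
rewrite -polyCM mulKf // dvd_compl ?eqSS; [ | by lia | by lia].
by rewrite (inj_eq val_inj) polyC_natr; case: eqP => [-> | //]; case: eqP.
Qed.

(** * Orthogonality, basicness and degree *)

(** Every exponent sum lies between 1 and r + s + 1 < n, so none is a multiple of n. *)
Lemma pairing_const_pencil : pairing const_block pencil_block = 0.
Proof.
apply/pairing_pencil_eq0; rewrite const_blockM.
have -> : const_block *m (map_mx polyC pencil_coef)^T = 0.
  apply: trmx_inj; rewrite trmx_mul trmxK trmx0 map_trmx -map_mxM pencil_coefM.
  apply/matrixP=> i k; rewrite !mxE dvdF ?mulr0 //.
  by have := ltn_ord k; lia.
apply/matrixP=> i k; rewrite !mxE dvdF ?mulr0 ?addr0 //.
by have := ltn_ord i; have := ltn_ord k; lia.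
Qed.

Local Notation stab := (stabilizer const_block pencil_block).

Lemma stabilizer_basic : basic stab.
Proof.
exists (block_mx (map_mx polyC (dual_mx r)^T) 0 0 (map_mx polyC (dual_mx s.+1)^T)).
rewrite mulmx_block const_block_dual pencil_block_dual !mul0mx !mulmx0.
by rewrite !addr0 add0r -scalar_mx_block.
Qed.

(** The chosen constant matrix makes the product block diagonal, with blocks 1 and diag(1, ..., 1,
    D^g), hence of determinant D^g. *)
Lemma stabilizer_constraint_length_min m (M : 'M[polyF]_(m, n + n)) :
  basic M -> (forall v, row_module M v <-> row_module stab v) ->
  (g <= constraint_length M)%N.
Proof.
move=> M_basic /(constraint_length_ge
  (block_mx (dual_mx r)^T 0 0 lead_dual_mx^T) stabilizer_basic M_basic).
rewrite map_block_mx !map_mx0 mulmx_block const_block_dual pencil_block_lead_dual.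
rewrite !mul0mx !mulmx0 !addr0 add0r det_lblock det1 mul1r det_diag.
rewrite (bigD1 ord_max) //= mxE eqxx big1 ?mulr1 ?size_polyXn // => i i_max.
by rewrite mxE (negPf i_max).
Qed.

(** Minimality applied to the stabilizer itself gives the lower bound; for the upper one, all rows
    but the last are constant. *)
Lemma stabilizer_constraint_length : constraint_length stab = g.
Proof.
apply/eqP; rewrite eqn_leq stabilizer_constraint_length_min ?andbT //;
  last exact: stabilizer_basic.
rewrite /constraint_length big_split_ord /= big1 ?add0n => [|i _].
  rewrite (bigD1 ord_max) //= big1 ?addn0 => [|i /negPf i_max].
    apply/bigmax_leqP=> j _.
    case: (split_ordP j) => k ->; rewrite ?block_mxEdl ?block_mxEdr.
      by rewrite mxE size_poly0.
    rewrite -subn1 leq_subLR add1n !mxE; apply: leq_trans (size_polyD _ _) _.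
    by rewrite geq_max (leq_trans (size_polyC_leq1 _)) //= eqxx mulr1 size_polyXn.
  apply/eqP; rewrite -leqn0; apply/bigmax_leqP=> j _.
  case: (split_ordP j) => k ->; rewrite ?block_mxEdl ?block_mxEdr mxE ?size_poly0 //.
  by rewrite !mxE i_max mulr0 addr0 -subn1 leq_subLR size_polyC_leq1.
apply/eqP; rewrite -leqn0; apply/bigmax_leqP=> j _.
case: (split_ordP j) => k ->; rewrite ?block_mxEul ?block_mxEur !mxE ?size_poly0 //.
by rewrite -subn1 leq_subLR size_polyC_leq1.
Qed.

(** * Weights in the two duals *)

Lemma coef_mul_const m l (u : 'rV[polyF]_m) (M : 'M[F]_(l, m)) k a :
  ((u *m (map_mx polyC M)^T) 0 k)`_a = \sum_j (u 0 j)`_a * M k j.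
Proof. by rewrite mxE coef_sum; apply: eq_bigr => j _; rewrite !mxE coefMC. Qed.

Local Notation coef_row a u := (map_mx (fun p : polyF => p`_a) u).

Lemma lowest_coef (u : 'rV[polyF]_n) :
  u != 0 -> exists2 a, coef_row a u != 0 & forall b, (b < a)%N -> coef_row b u = 0.
Proof.
move=> /rV0Pn[j uj0].
have ex : exists a, coef_row a u != 0.
  exists (size (u 0 j)).-1; apply/rV0Pn; exists j.
  by rewrite mxE -lead_coefE lead_coef_eq0.
case: (ex_minnP ex) => a ua min_a; exists a => // b; apply: contraTeq => /min_a.
by rewrite -leqNgt.
Qed.

(** Constant checks act on each coefficient vector separately, so a nonzero one satisfies the BCH
    conditions at exponents 1, ..., r. *)
Lemma weight_const_dual (u : 'rV[polyF]_n) :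
  pairing u const_block = 0 -> u != 0 -> (r < weight u)%N.
Proof.
move=> /pairing_const_eq0 u_dual /lowest_coef[a ua _].
apply: leq_trans (weight_coef u a).
have -> : [set j | ((u 0 j)`_a != 0)%R] = [set j | (coef_row a u 0 j != 0)%R].
  by apply/setP=> j; rewrite !inE mxE.
apply: (power_mx_bch (a := 1)) => // k lt_k.
transitivity ((u *m (powC (fun i : 'I_r => i.+1))^T) 0 (Ordinal lt_k))`_a.
  by rewrite coef_mul_const; apply: eq_bigr => j _; rewrite !mxE.
by rewrite u_dual mxE coef0.
Qed.

(* The lowest coefficient of u is orthogonal to v_0 because the equation
   D^g <u, v_(s+1)> + <u, v_0> = 0 has no term in v_(s+1) at that degree. *)
Lemma weight_pencil_dual (u : 'rV[polyF]_n) :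
  pairing u pencil_block = 0 -> u != 0 -> (s.+1 < weight u)%N.
Proof.
move=> /pairing_pencil_eq0/matrixP u_dual /lowest_coef[a ua low].
apply: leq_trans (weight_coef u a).
have -> : [set j | ((u 0 j)`_a != 0)%R] = [set j | (coef_row a u 0 j != 0)%R].
  by apply/setP=> j; rewrite !inE mxE.
pose P0 := u *m (powC (fun i : 'I_s.+1 => i.+1))^T.
pose P1 := u *m (map_mx polyC pencil_coef)^T.
have P01 k : 'X^g * P0 0 k + P1 0 k = 0.
  by have := u_dual 0 k; rewrite [LHS]mxE [X in X + _]mxE [RHS]mxE.
have coef_low k b : (b < a)%N -> (P0 0 k)`_b = 0.
  move=> /low/matrixP low_b; rewrite coef_mul_const big1 // => j _.
  by have := low_b 0 j; rewrite !mxE => ->; rewrite mul0r.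
(* Exponents 0, ..., s: exponent 0 comes from the last row of the pencil, the others from its
   constant rows. *)
apply: (power_mx_bch (a := 0)) => // -[|k] lt_k.
  have /(congr1 (fun p : polyF => p`_a)) := P01 ord_max.
  rewrite coefD coefXnM coef0 [X in _ + X]coef_mul_const.
  have -> : (if (a < g)%N then 0 else (P0 0 ord_max)`_(a - g)) = 0.
    by case: ltnP => // le_ga; rewrite coef_low //; lia.
  rewrite add0r => E; rewrite -[RHS]E; apply: eq_bigr => j _.
  by rewrite !mxE eqxx addn0 muln0 expr0.
have lt_ks : (k < s.+1)%N by lia.
have P1k : P1 0 (Ordinal lt_ks) = 0.
  rewrite mxE big1 // => j _; rewrite !mxE -val_eqE /= ltn_eqF ?mulr0 //.
have /eqP := P01 (Ordinal lt_ks).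
rewrite P1k addr0 mulf_eq0 -size_poly_eq0 size_polyXn /= => /eqP P0k.
transitivity (P0 0 (Ordinal lt_ks))`_a; last by rewrite P0k coef0.
by rewrite coef_mul_const; apply: eq_bigr => j _; rewrite !mxE add0n.
Qed.

(** * Nonemptiness of the two distance sets *)

Lemma const_block_powC e : (e < n - r)%N ->
  const_block *m (powC (fun _ : 'I_1 => e))^T = 0.
Proof.
move=> lt_e; rewrite const_blockM; apply/matrixP=> i k; rewrite !mxE dvdF ?mulr0 //.
by have := ltn_ord i; lia.
Qed.

Local Notation rowC e := (powC (fun _ : 'I_1 => e)).

Lemma rowCM a b : rowC a *m (rowC b)^T = (n%:R * (n %| a + b)%:R)%:P%:M.
Proof.
rewrite map_trmx -map_mxM power_mxM; apply/matrixP=> i k.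
by rewrite !ord1 !mxE.
Qed.

Lemma exists_dual_pencil : exists u : 'rV[polyF]_n,
  edual (row_module pencil_block) u /\ ~ row_module const_block u.
Proof.
(* Both <v_(n-s-1), v_(s+1)> and <v_0, v_0> equal n, so their D^g multiples cancel in the last
   equation; all other products vanish. *)
exists (rowC (n - s.+1)%N - 'X^g *: rowC 0%N); split.
  apply/edual_row_moduleP/pairing_pencil_eq0.
  have rowC_coefT e : rowC e *m (map_mx polyC pencil_coef)^T
      = \matrix_(i, k) ((k == ord_max)%:R * (n%:R * (n %| e)%:R))%:P.
    apply: trmx_inj; rewrite trmx_mul trmxK map_trmx -map_mxM pencil_coefM.
    by apply/matrixP=> i k; rewrite !mxE.
  rewrite !mulmxBl -!scalemxAl !rowC_coefT !map_trmx -!map_mxM !power_mxM.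
  apply/matrixP=> i k; have lt_k := ltn_ord k; rewrite !mxE add0n.
  rewrite (dvdF (a := k.+1)) ?(dvdF (a := n - s.+1)); [ | lia | lia].
  rewrite addnC dvd_compl ?eqSS; [ | lia | lia].
  rewrite dvdn0 /= !mulr0n !mulr0 polyC0 subr0 add0r mulr1 -val_eqE /=.
  by rewrite [_ * n%:R]mulrC subrr.
(* The rows of [const_block] are orthogonal to v_0, but the witness pairs with v_0 to -n D^g. *)
case=> w /(congr1 (fun M => M *m (rowC 0%N)^T)).
rewrite -mulmxA const_block_powC ?mulmx0; last by lia.
rewrite mulmxBl -scalemxAl !rowCM addn0 dvdF ?mulr0 ?sub0r; last by lia.
move/matrixP/(_ 0 0)/eqP; rewrite !mxE dvdn0 /= !mulr1n polyC0 sub0r mulr1.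
rewrite oppr_eq0 mulf_eq0.
by rewrite polyC_eq0 (negPf n_neq0) orbF (negPf (monic_neq0 (monicXn F g))).
Qed.

Lemma exists_dual_const : exists u : 'rV[polyF]_n,
  edual (row_module const_block) u /\ ~ row_module pencil_block u.
Proof.
exists (rowC 0%N); split.
  apply/edual_row_moduleP/pairing_const_eq0/trmx_inj.
  by rewrite trmx_mul trmxK trmx0 const_block_powC //; lia.
case=> w Ew.
(* In this range the rows before the last have exponent sums strictly between 0 and n, so
   multiplying v_0 = w B by v_e isolates the last coordinate of [w]. *)
have inner e : (e <= n - s.+1)%N ->
    ((n %| e)%:R = w 0 ord_max * ((e == n - s.+1)%N%:R + 'X^g * (n %| e)%:R) :> polyF).
  move=> le_e; have := congr1 (fun M => (M *m (rowC e)^T) 0 0) Ew.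
  have dvdS (i : 'I_s.+1) : (n %| i.+1 + e)%N = (i.+1 + e == n)%N.
    have lt_i := ltn_ord i; case: eqP => [-> | ne]; first exact: dvdnn.
    by rewrite dvdF //; lia.
  rewrite rowCM -mulmxA pencil_blockM !mxE add0n mulr1n => E.
  have n_unit : n%:R%:P != 0 :> polyF by rewrite polyC_eq0.
  apply: (mulfI n_unit); rewrite -polyC_natr -polyCM E.
  rewrite (bigD1 ord_max) //= big1 ?addr0 => [|k k_max].
    rewrite mxE eqxx mul1r dvdS /= !polyCM !polyC_natr.
    have -> : (s.+1 + e == n)%N = (e == n - s.+1)%N by lia.
    by ring.
  rewrite mxE dvdS (negPf k_max) mul0r mulr0 addr0.
  have -> : (k.+1 + e == n)%N = false.
    by move: k_max; rewrite -val_eqE /= => k_max; have := ltn_ord k; lia.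
  by rewrite !mulr0.
(* The choice e = n - s - 1 makes that coordinate 0; then e = 0 yields 1 = 0. *)
have := inner (n - s.+1)%N; rewrite dvdF ?eqxx ?mulr0 ?addr0 ?mulr1; last by lia.
move=> /(_ (leqnn _)) w0; have := inner 0%N (leq0n _).
by rewrite -w0 mul0r dvdn0 => /eqP; rewrite oner_eq0.
Qed.

(** * Parameters of the resulting code *)

Lemma aqcc_primitive_root : exists mu dz dx : nat,
  [/\ aqcc F n (n - (r + s.+1)) mu g dz dx,
      (maxn r.+1 s.+2 <= dz)%N & (minn r.+1 s.+2 <= dx)%N].
Proof.
have [u1 Tu1] := exists_dual_pencil; have [u2 Tu2] := exists_dual_const.
have [d1 d1P] := min_weight_exists
  (T := fun v => edual (row_module pencil_block) v /\ ~ row_module const_block v) Tu1.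
have [d2 d2P] := min_weight_exists
  (T := fun v => edual (row_module const_block) v /\ ~ row_module pencil_block v) Tu2.
(* Zero lies in both row modules, so elements of the distance sets are nonzero and the weight bounds
   apply. *)
have row0 m (M : 'M[polyF]_(m, n)) : row_module M 0 by exists 0; rewrite mul0mx.
have le1 : (s.+2 <= d1)%N.
  have [[v [/edual_row_moduleP v_dual v_const] <-] _] := d1P.
  by apply: weight_pencil_dual => //; apply/eqP=> v0; apply: v_const; rewrite v0.
have le2 : (r.+1 <= d2)%N.
  have [[v [/edual_row_moduleP v_dual v_pencil] <-] _] := d2P.
  by apply: weight_const_dual => //; apply/eqP=> v0; apply: v_pencil; rewrite v0.
exists (memory stab), (maxn d1 d2), (minn d1 d2); split; [ | lia | lia].
exists r, s.+1, const_block, pencil_block; split=> //.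
- exact: stabilizer_basic.
- exact: pairing_const_pencil.
- lia.
- by rewrite stabilizer_constraint_length.
- exact: stabilizer_constraint_length_min.
- by exists d1, d2; split.
Qed.

End PrimitiveRoot.
End AsymmetricConvolutional.

(** * Specialisation to finite fields *)

(** The q - 1 nonzero elements are all roots of X^(q-1) - 1, so one of them is primitive. *)
Lemma finField_prim_root (F : finFieldType) :
  exists z : F, ((#|F|.-1).-primitive_root z)%R.
Proof.
have cardF : #|F| = #|F|.-1.+1 by rewrite prednK // (ltnW (finNzRing_gt1 F)).
have /hasP[z _ z_prim] : has (#|F|.-1).-primitive_root%R (enum (predC1 (0%R : F))).
  apply: has_prim_root; rewrite ?enum_uniq -?cardE ?cardC1 //.
    by rewrite -ltnS -cardF finNzRing_gt1.
  apply/allP=> x; rewrite mem_enum => /= x0; apply/unity_rootP.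
  by apply: (GRing.mulfI x0); rewrite -GRing.exprS -cardF expf_card GRing.mulr1.
by exists z.
Qed.

Theorem theorem3p8 (q : nat) (F : finFieldType) (hF : #|F| = q) (hq : 8 <= q) :
  (forall i t : nat, 1 <= t <= i - 2 -> 3 <= i <= q - 3 ->
     exists mu dz dx : nat,
       [/\ aqcc F (q - 1) (i - t - 1) mu 3 dz dx,
           maxn (q - i - 1) (t + 2) <= dz
         & minn (q - i - 1) (t + 2) <= dx])
  /\
  (forall i t : nat, 1 <= t <= i - 1 -> 2 <= i <= q - 3 ->
     exists mu dz dx : nat,
       [/\ aqcc F (q - 1) (i - t) mu 2 dz dx,
           maxn (q - i - 1) (t + 2) <= dz
         & minn (q - i - 1) (t + 2) <= dx]).
Proof.
have [z] := finField_prim_root F; rewrite hF -subn1 => z_prim.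
split=> i t it iq.
  (* Here r + 1 = q - i - 1 and s + 2 = t + 3, and r + s + 1 < n reads t <= i - 2. *)
  have [|//|mu [dz [dx [code dz_ge dx_ge]]]] :=
    @aqcc_primitive_root _ _ _ z_prim (q - i - 2) t.+1 3; first by lia.
  exists mu, dz, dx; split; [ | lia | lia].
  by have -> : i - t - 1 = (q - 1 - (q - i - 2 + t.+2))%N by lia.
(* Now s + 2 = t + 2, and r + s + 1 < n reads t <= i - 1. *)
have [|//|mu [dz [dx [code dz_ge dx_ge]]]] :=
  @aqcc_primitive_root _ _ _ z_prim (q - i - 2) t 2; first by lia.
exists mu, dz, dx; split; [ | lia | lia].
by have -> : i - t = (q - 1 - (q - i - 2 + t.+1))%N by lia.
Qed.
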